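(* The locally ordered 2-category $\mathbf{Sup}_{\mathrm{mod}}$ of complete modular lattices and join-preserving maps is 2-di-exact.
   Context: $\mathbf{Sup}$ is the 2-category whose objects are the complete lattices (small with respect to a fixed Grothendieck universe), whose 1-cells $L\to M$ are the maps preserving all joins (including the empty one, so $\bot\mapsto\bot$), and in which there is exactly one 2-cell $f\Rightarrow g$ when $f\le g$ pointwise and none otherwise. It is locally ordered: between parallel 1-cells there is at most one 2-cell, and parallel 1-cells with 2-cells in both directions are equal. $\mathbf{Sup}_{\mathrm{mod}}$ is its full sub-2-category on the complete lattices that are modular. A bizero object of a 2-category $\mathcal L$ is an object $0$ such that for every object $A$ the hom-categories $\mathcal L(A,0)$ and $\mathcal L(0,A)$ are equivalent to the terminal category. A 1-cell is null if it factors through $0$; $f\cong 0$ means that $f$ is isomorphic (via an invertible 2-cell) to a null 1-cell. The bizero object is strong if between any two parallel 1-cells that factor through $0$ there is exactly one 2-cell. In a 2-category with a strong bizero object, a 2-kernel of $f\colon A\to B$ is a 1-cell $k\colon K\to A$ with an invertible 2-cell $f\circ k\cong 0$ such that (1) for every $z\colon Z\to A$ with $f\circ z\cong0$ there is $u\colon Z\to K$ with $k\circ u\cong z$; (2) for all $u,v\colon Z\to K$ and every 2-cell $\lambda\colon k\circ u\Rightarrow k\circ v$ there is a unique 2-cell $\mu\colon u\Rightarrow v$ whose whiskering with $k$ is $\lambda$. 2-cokernels are defined dually. A normal 2-monomorphism is a 1-cell which is a 2-kernel of some 1-cell; a normal 2-epimorphism is a 1-cell which is a 2-cokernel of some 1-cell.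 A 1-cell is normal if it is isomorphic to $m\circ e$ with $e$ a normal 2-epimorphism and $m$ a normal 2-monomorphism; it is antinormal if it is isomorphic to $e\circ m$ with $m$ a normal 2-monomorphism and $e$ a normal 2-epimorphism. A 2-category with a strong bizero object is 2-di-exact if it has all 2-kernels and all 2-cokernels and every antinormal 1-cell is normal. *)

(* Defs.v *)
From HB Require Import structures.
From mathcomp Require Import all_boot all_order.
From mathcomp Require Import boolp classical_sets.

Set Implicit Arguments.
Unset Strict Implicit.
Unset Printing Implicit Defensive.

Import Order.TTheory.

#[local] Obligation Tactic := idtac.

Record category := Category {
  obj :> Type;
  mor : obj -> obj -> Type;
  idm : forall x, mor x x;
  compm : forall x y z, mor y z -> mor x y -> mor x z;
  compm1 : forall x y (a : mor x y), compm a (idm x) = a;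
  comp1m : forall x y (a : mor x y), compm (idm y) a = a;
  compmA : forall x y z t (c : mor z t) (b : mor y z) (a : mor x y),
    compm c (compm b a) = compm (compm c b) a
}.
Arguments mor {_} _ _.
Arguments idm {_} x.
Arguments compm {_ x y z} _ _.

Record functor (C D : category) := Functor {
  fobj :> C -> D;
  fmor : forall x y : C, mor x y -> mor (fobj x) (fobj y);
  fmor1 : forall x : C, fmor (idm x) = idm (fobj x);
  fmorM : forall (x y z : C) (b : mor y z) (a : mor x y),
    fmor (compm b a) = compm (fmor b) (fmor a)
}.
Arguments fmor {C D} _ {x y} _.

Definition invertible (C : category) (x y : C) (a : mor x y) : Prop :=
  exists b : mor y x, compm b a = idm x /\ compm a b = idm y.

Definition isomorphic (C : category) (x y : C) : Prop :=
  exists a : mor x y, invertible a.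

Definition naturally_isomorphic (C D : category) (F G : functor C D) : Prop :=
  exists t : forall x, mor (F x) (G x),
    (forall x y (a : mor x y), compm (fmor G a) (t x) = compm (t y) (fmor F a))
    /\ (forall x, invertible (t x)).

Program Definition idF (C : category) : functor C C :=
  @Functor C C id (fun _ _ a => a) _ _.
Next Obligation. by []. Qed.
Next Obligation. by []. Qed.

Program Definition compF (C D E : category) (G : functor D E) (F : functor C D)
    : functor C E :=
  @Functor C E (fun x => G (F x)) (fun _ _ a => fmor G (fmor F a)) _ _.
Next Obligation. by move=> C D E G F x /=; rewrite !fmor1. Qed.
Next Obligation. by move=> C D E G F x y z b a /=; rewrite !fmorM. Qed.

Definition equivalent (C D : category) : Prop :=
  exists (F : functor C D) (G : functor D C),
    naturally_isomorphic (compF G F) (idF C)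
    /\ naturally_isomorphic (compF F G) (idF D).

Program Definition terminal_category : category :=
  @Category unit (fun _ _ => unit) (fun _ => tt) (fun _ _ _ _ _ => tt) _ _ _.
Next Obligation. by move=> _ _ []. Qed.
Next Obligation. by move=> _ _ []. Qed.
Next Obligation. by []. Qed.

Program Definition prod_category (C D : category) : category :=
  @Category (C * D) (fun p q => (mor p.1 q.1 * mor p.2 q.2)%type)
    (fun p => (idm p.1, idm p.2))
    (fun _ _ _ b a => (compm b.1 a.1, compm b.2 a.2)) _ _ _.
Next Obligation. by move=> C D x y [a1 a2] /=; rewrite !compm1. Qed.
Next Obligation. by move=> C D x y [a1 a2] /=; rewrite !comp1m. Qed.
Next Obligation. by move=> C D x y z t c b a /=; rewrite !compmA. Qed.

Program Definition fstF (C D : category) : functor (prod_category C D) C :=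
  @Functor (prod_category C D) C fst (fun _ _ a => a.1) _ _.
Next Obligation. by []. Qed.
Next Obligation. by []. Qed.

Program Definition sndF (C D : category) : functor (prod_category C D) D :=
  @Functor (prod_category C D) D snd (fun _ _ a => a.2) _ _.
Next Obligation. by []. Qed.
Next Obligation. by []. Qed.

Program Definition pairF (E C D : category) (F : functor E C) (G : functor E D)
    : functor E (prod_category C D) :=
  @Functor E (prod_category C D) (fun x => (F x, G x))
    (fun _ _ a => (fmor F a, fmor G a)) _ _.
Next Obligation. by move=> E C D F G x /=; rewrite !fmor1. Qed.
Next Obligation. by move=> E C D F G x y z b a /=; rewrite !fmorM. Qed.

Program Definition constF (C D : category) (d : D) : functor C D :=
  @Functor C D (fun _ => d) (fun _ _ _ => idm d) _ _.
Next Obligation. by []. Qed.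
Next Obligation. by move=> C D d x y z b a /=; rewrite compm1. Qed.

(* A 2-category is a category enriched in categories.  The associativity and
   unit laws are equalities of functors, so they hold for 1-cells and 2-cells
   at once and no transport of 2-cells along equalities is needed. *)
Record two_category := TwoCategory {
  cell0 :> Type;
  hom : cell0 -> cell0 -> category;
  id1 : forall A, hom A A;
  compH : forall A B C, functor (prod_category (hom B C) (hom A B)) (hom A C);
  compH1 : forall A B,
    compF (compH A A B) (pairF (idF (hom A B)) (constF (hom A B) (id1 A)))
    = idF (hom A B);
  comp1H : forall A B,
    compF (compH A B B) (pairF (constF (hom A B) (id1 B)) (idF (hom A B)))
    = idF (hom A B);
  compHA : forall A B C D,
    let dom := prod_category (prod_category (hom C D) (hom B C)) (hom A B) in
    let p1 : functor dom (hom C D) := compF (fstF _ _) (fstF _ _) in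
    let p2 : functor dom (hom B C) := compF (sndF _ _) (fstF _ _) in
    let p3 : functor dom (hom A B) := sndF _ _ in
    compF (compH A C D) (pairF p1 (compF (compH A B C) (pairF p2 p3)))
    = compF (compH A B D) (pairF (compF (compH B C D) (pairF p1 p2)) p3)
}.
Arguments hom {_} _ _.
Arguments id1 {_} A.
Arguments compH {_} A B C.

Definition comp1 (K : two_category) (A B C : K) (g : hom B C) (f : hom A B)
    : hom A C :=
  compH A B C (g, f).

Notation "g ∘ f" := (comp1 g f) (at level 40, left associativity).
Notation "f ⇒ g" := (mor f g) (at level 70, no associativity).
Notation "f ≅ g" := (isomorphic f g) (at level 70, no associativity).

Definition whiskerl (K : two_category) (A B C : K) (k : hom B C)
    (u v : hom A B) (mu : u ⇒ v) : k ∘ u ⇒ k ∘ v :=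
  @fmor _ _ (compH A B C) (k, u) (k, v) (idm k, mu).

Definition whiskerr (K : two_category) (A B C : K) (c : hom A B)
    (u v : hom B C) (mu : u ⇒ v) : u ∘ c ⇒ v ∘ c :=
  @fmor _ _ (compH A B C) (u, c) (v, c) (mu, idm c).

Definition locally_ordered (K : two_category) : Prop :=
  forall (A B : K) (f g : hom A B),
    (forall a b : f ⇒ g, a = b) /\ ((f ⇒ g) -> (g ⇒ f) -> f = g).

Program Definition full_sub (K : two_category) (P : K -> Prop) : two_category :=
  @TwoCategory {A : K | P A}
    (fun A B => hom (proj1_sig A) (proj1_sig B))
    (fun A => id1 (proj1_sig A))
    (fun A B C => compH (proj1_sig A) (proj1_sig B) (proj1_sig C)) _ _ _.
Next Obligation. by move=> K P A B; apply: compH1. Qed.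
Next Obligation. by move=> K P A B; apply: comp1H. Qed.
Next Obligation. by move=> K P A B C D; apply: compHA. Qed.

Section TwoDiExact.
Variable K : two_category.

Definition bizero (O : K) : Prop :=
  forall A : K, equivalent (hom A O) terminal_category
             /\ equivalent (hom O A) terminal_category.

Definition null (O A B : K) (f : hom A B) : Prop :=
  exists (p : hom A O) (q : hom O B), f = q ∘ p.

(* This is the relation written [f ≅ 0]. *)
Definition iso_null (O A B : K) (f : hom A B) : Prop :=
  exists n : hom A B, null O n /\ f ≅ n.

Definition strong_bizero (O : K) : Prop :=
  bizero O /\
  forall (A B : K) (f g : hom A B), null O f -> null O g ->
    exists! a : f ⇒ g, True.

(* The invertible 2-cell [f ∘ k ≅ 0] is only required to exist: when [O] is a
   strong bizero object it is unique. *)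
Definition two_kernel (O A B : K) (f : hom A B) (X : K) (k : hom X A) : Prop :=
  [/\ iso_null O (f ∘ k),
      forall (Z : K) (z : hom Z A), iso_null O (f ∘ z) ->
        exists u : hom Z X, k ∘ u ≅ z
    & forall (Z : K) (u v : hom Z X) (lambda : k ∘ u ⇒ k ∘ v),
        exists! mu : u ⇒ v, whiskerl k mu = lambda].

Definition two_cokernel (O A B : K) (f : hom A B) (X : K) (c : hom B X) : Prop :=
  [/\ iso_null O (c ∘ f),
      forall (Z : K) (z : hom B Z), iso_null O (z ∘ f) ->
        exists u : hom X Z, u ∘ c ≅ z
    & forall (Z : K) (u v : hom X Z) (lambda : u ∘ c ⇒ v ∘ c),
        exists! mu : u ⇒ v, whiskerr c mu = lambda].

Definition normal_mono (O X A : K) (m : hom X A) : Prop :=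
  exists (B : K) (f : hom A B), two_kernel O f m.

Definition normal_epi (O B X : K) (e : hom B X) : Prop :=
  exists (A : K) (f : hom A B), two_cokernel O f e.

Definition normal (O A B : K) (f : hom A B) : Prop :=
  exists (I : K) (e : hom A I) (m : hom I B),
    [/\ normal_epi O e, normal_mono O m & f ≅ m ∘ e].

Definition antinormal (O A B : K) (f : hom A B) : Prop :=
  exists (I : K) (m : hom A I) (e : hom I B),
    [/\ normal_mono O m, normal_epi O e & f ≅ e ∘ m].

Definition two_di_exact : Prop :=
  exists O : K,
    [/\ strong_bizero O,
        forall (A B : K) (f : hom A B),
          exists (X : K) (k : hom X A), two_kernel O f k,
        forall (A B : K) (f : hom A B),
          exists (X : K) (c : hom B X), two_cokernel O f c
      & forall (A B : K) (f : hom A B), antinormal O f -> normal O f].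

End TwoDiExact.

(* The carriers of [latticeType]s all live in one fixed
   universe, which plays the role of the Grothendieck universe, and the objects
   of [Sup] live in a larger one. *)
Record complete_lattice := CompleteLattice {
  cl_disp : Order.disp_t;
  cl_sort :> latticeType cl_disp;
  cl_complete : forall A : set cl_sort, exists s, isLub A s
}.

Definition modular (L : complete_lattice) : Prop :=
  forall x y z : L, (x <= z)%O ->
    (x `|` (y `&` z) = (x `|` y) `&` z)%O.

Record sup_map (L M : complete_lattice) := SupMap {
  sup_fun :> L -> M;
  sup_funP : forall (A : set L) (s : L), isLub A s ->
    isLub [set sup_fun x | x in A]%classic (sup_fun s)
}.

Lemma sup_map_eq (L M : complete_lattice) (f g : sup_map L M) :
  (forall x, f x = g x) -> f = g.
Proof.
case: f g => [f fP] [g gP] /= /funext fg; move: gP; rewrite -fg => gP.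
by rewrite (Prop_irrelevance fP gP).
Qed.

Definition sup_le (L M : complete_lattice) (f g : sup_map L M) : Prop :=
  forall x, (f x <= g x)%O.

Program Definition sup_id (L : complete_lattice) : sup_map L L :=
  @SupMap L L id _.
Next Obligation. by move=> L A s; rewrite image_id. Qed.

Program Definition sup_comp (L M N : complete_lattice)
    (g : sup_map M N) (f : sup_map L M) : sup_map L N :=
  @SupMap L N (fun x => g (f x)) _.
Next Obligation.
move=> L M N g f A s As.
have := sup_funP g (sup_funP f As); rewrite image_comp; exact.
Qed.

Program Definition sup_hom (L M : complete_lattice) : category :=
  @Category (sup_map L M) (@sup_le L M) _ _ _ _ _.
Next Obligation. by move=> L M f x. Qed.
Next Obligation. by move=> L M f g h gh fg x; apply: le_trans (fg x) (gh x). Qed.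
Next Obligation. by move=> *; apply: Prop_irrelevance. Qed.
Next Obligation. by move=> *; apply: Prop_irrelevance. Qed.
Next Obligation. by move=> *; apply: Prop_irrelevance. Qed.

Lemma sup_cell_irr (L M : complete_lattice) (f g : sup_hom L M)
    (a b : mor f g) :
  a = b.
Proof. exact: (@Prop_irrelevance (sup_le f g)). Qed.

Lemma sup_map_homo (L M : complete_lattice) (f : sup_map L M) (x y : L) :
  (x <= y)%O -> (f x <= f y)%O.
Proof.
move=> xy.
have /(sup_funP f)[ub _] : isLub [set x; y]%classic y.
  split; last by move=> b; apply; right.
  by move=> z [->|->].
by apply: ub; exists x => //; left.
Qed.

Program Definition sup_compH (L M N : complete_lattice)
    : functor (prod_category (sup_hom M N) (sup_hom L M)) (sup_hom L N) :=
  @Functor (prod_category (sup_hom M N) (sup_hom L M)) (sup_hom L N)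
    (fun p => sup_comp p.1 p.2) _ _ _.
Next Obligation.
move=> L M N p q [le1 le2] x /=.
by apply: le_trans (le1 _) _; apply/sup_map_homo/le2.
Qed.
Next Obligation. by move=> *; apply: sup_cell_irr. Qed.
Next Obligation. by move=> *; apply: sup_cell_irr. Qed.

Lemma sup_functor_eq (C : category) (L M : complete_lattice)
    (F G : functor C (sup_hom L M)) :
  (forall x, F x = G x) -> F = G.
Proof.
case: F G => [F Fm F1 FM] [G Gm G1 GM] /= /funext FG.
move: Gm G1 GM; rewrite -FG => Gm G1 GM.
have FGm : Fm = Gm.
  apply: functional_extensionality_dep => x.
  apply: functional_extensionality_dep => y.
  by apply: funext => a; apply: sup_cell_irr.
move: G1 GM; rewrite -FGm => G1 GM.
by rewrite (Prop_irrelevance F1 G1) (Prop_irrelevance FM GM).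
Qed.

Program Definition Sup : two_category :=
  @TwoCategory complete_lattice sup_hom sup_id sup_compH _ _ _.
Next Obligation. by move=> L M; apply: sup_functor_eq => f; apply: sup_map_eq. Qed.
Next Obligation. by move=> L M; apply: sup_functor_eq => f; apply: sup_map_eq. Qed.
Next Obligation.
by move=> L M N P; apply: sup_functor_eq => f; apply: sup_map_eq.
Qed.

Definition Sup_mod : two_category := full_sub (K := Sup) modular.

Lemma Sup_mod_locally_ordered : locally_ordered Sup_mod.
Proof.
move=> L M f g; split=> [a b|fg gf]; first exact: sup_cell_irr.
by apply: sup_map_eq => x; apply/eqP; rewrite eq_le fg gf.
Qed.

(* Main.v *)
From HB Require Import structures.
From mathcomp Require Import all_boot all_order.
From mathcomp Require Import boolp classical_sets.
Require Import Defs.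

Set Implicit Arguments.
Unset Strict Implicit.
Unset Printing Implicit Defensive.

Import Order.TTheory.

Local Open Scope order_scope.

(** Write [bot] and [top] for the extreme elements of a complete lattice.  The
    one-point lattice is a strong bizero object, and a 1-cell is isomorphic to
    a null one exactly when it is constantly [bot].  Since 2-cells are
    inequalities, kernels and cokernels are described by order conditions:

    - [k] is a 2-kernel of [f] iff [k] is an order embedding with image
      [{y | f y = bot}], a principal ideal ([two_kernelP]);
    - [c] is a 2-cokernel of [f] iff [c] is surjective and [c x <= c y] is
      equivalent to [x <= y `|` f top], that is, [c] is the projection
      [x |-> x `|` f top] onto a principal filter ([two_cokernelP]).

    Intervals of a complete modular lattice are complete and modular, which
    gives existence.

    An antinormal 1-cell is, up to isomorphism, [x |-> x `|` b] from the ideal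
    of some [a] to the filter of [b], inside one modular lattice.  It factors
    through the diamond isomorphism between [[a `&` b, a]] and [[b, a `|` b]],
    where the projection onto the first interval is a normal 2-epimorphism and
    the inclusion of the second one a normal 2-monomorphism.  In terms of an
    antinormal [f] with kernel [k], modularity gives two facts: [f x <= f y]
    implies [x <= y `|` a'] for some [a'] with [f a' = bot]
    ([antinormal_le]), and the image of [f] is downward closed
    ([antinormal_down]).  By the first one the 1-cell induced by [f] on the
    2-cokernel of [k] is an order embedding; by the second one its image is the
    ideal of [f top], so it is a 2-kernel of the 2-cokernel of [f]. *)

(** * Joins in complete lattices and join-preserving maps *)

Section Lub.
Variable L : complete_lattice.
Implicit Types (A : set L) (x y : L).

(** The join of a set, chosen among its (unique) least upper bounds. *)
Definition lub A : L := projT1 (cid (cl_complete A)).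

Lemma lubP A : isLub A (lub A).
Proof. by rewrite /lub; case: cid. Qed.

Lemma lub_ub A x : A x -> x <= lub A.
Proof. by have [+ _] := lubP A; apply. Qed.

Lemma lub_le A y : (forall x, A x -> x <= y) -> lub A <= y.
Proof. by have [_ +] := lubP A => h Ay; apply: h. Qed.

Lemma isLub_lub A s : isLub A s -> s = lub A.
Proof.
case=> sub sle; apply: le_anti; rewrite lub_le // andbT.
by apply: sle => x; apply: lub_ub.
Qed.

Definition bot : L := lub set0.
Definition top : L := lub setT.

Lemma bot_le x : bot <= x. Proof. exact: lub_le. Qed.
Lemma le_top x : x <= top. Proof. exact: lub_ub. Qed.

Lemma le_bot x : x <= bot -> x = bot.
Proof. by move=> xb; apply: le_anti; rewrite xb bot_le. Qed.

End Lub.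

Lemma sup_map_lub (L M : complete_lattice) (f : sup_map L M) (A : set L) y :
  (forall x, A x -> f x <= y) -> f (lub A) <= y.
Proof.
move=> Ay; have [_ h] := sup_funP f (lubP A).
by apply: h => _ [x Ax <-]; apply: Ay.
Qed.

Lemma sup_map_bot (L M : complete_lattice) (f : sup_map L M) :
  f (bot L) = bot M.
Proof. by apply/le_bot/sup_map_lub. Qed.

Lemma sup_mapU (L M : complete_lattice) (f : sup_map L M) x y :
  f (x `|` y) = f x `|` f y.
Proof.
apply: le_anti; rewrite leUx !sup_map_homo ?leUl ?leUr // !andbT.
apply: le_trans (_ : f (lub [set x; y]%classic) <= _).
  by rewrite sup_map_homo // leUx !lub_ub //; [right|left].
by apply: sup_map_lub => _ [->|->]; rewrite ?leUl ?leUr.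
Qed.

(** A monotone map which sends joins below every upper bound of the images
    preserves joins. *)
Section MkSupMap.
Variables (L M : complete_lattice) (f : L -> M).
Hypothesis f_homo : {homo f : x y / x <= y}.
Hypothesis f_lub : forall (A : set L) y,
  (forall x, A x -> f x <= y) -> f (lub A) <= y.

Lemma mk_sup_map_subproof (A : set L) (s : L) :
  isLub A s -> isLub [set f x | x in A]%classic (f s).
Proof.
move=> /isLub_lub ->; split=> [_ [x Ax <-]|y ub].
  exact/f_homo/lub_ub.
by apply: f_lub => x Ax; apply: ub; exists x.
Qed.

Definition mk_sup_map : sup_map L M := SupMap mk_sup_map_subproof.
End MkSupMap.

(** The map sending [bot] to [bot] and everything else to [y]. *)
Lemma point_map (L M : complete_lattice) (y : M) :
  exists p : sup_map L M,
    (forall x, p x <= y) /\ (forall x, x <> bot L -> p x = y).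
Proof.
pose p (x : L) := if x == bot L then bot M else y.
have p_le x : p x <= y by rewrite /p; case: ifP => // _; apply: bot_le.
have p_homo : {homo p : x x' / x <= x'}.
  move=> x x' xx'; rewrite /p; case: eqP => xb; first exact: bot_le.
  by case: eqP => // x'b; case: xb; apply: le_bot; rewrite -x'b.
have p_lub (A : set L) z : (forall x, A x -> p x <= z) -> p (lub A) <= z.
  move=> Az; rewrite {1}/p; case: eqP => [_|Ab]; first exact: bot_le.
  apply: contrapT => yz; apply/Ab/le_bot/lub_le => x Ax.
  by have := Az x Ax; rewrite /p; case: eqP => [->|_].
by exists (mk_sup_map p_homo p_lub); split=> //= x; rewrite /p; case: eqP.
Qed.

(** The map sending the elements below [y] to [bot] and the others to [top]. *)
Lemma copoint_map (L M : complete_lattice) (y : L) :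
  exists p : sup_map L M,
    (forall x, x <= y -> p x = bot M) /\ (forall x, ~ x <= y -> p x = top M).
Proof.
pose p (x : L) := if x <= y then bot M else top M.
have p_homo : {homo p : x x' / x <= x'}.
  move=> x x' xx'; rewrite /p; case: ifP => xy; first exact: bot_le.
  by case: ifP => // x'y; rewrite (le_trans xx' x'y) in xy.
have p_lub (A : set L) z : (forall x, A x -> p x <= z) -> p (lub A) <= z.
  move=> Az; rewrite {1}/p; case: ifP => [_|/negP Ay]; first exact: bot_le.
  apply: contrapT => yz; apply/Ay/lub_le => x Ax.
  by have := Az x Ax; rewrite /p; case: ifP.
exists (mk_sup_map p_homo p_lub); split=> x /=; rewrite /p; first by move=> ->.
by move/negP/negbTE ->.
Qed.

(** * Intervals *)

(** The interval [[a, b]] of a complete lattice; for [a = bot] it is the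
    principal ideal of [b] and for [b = top] the principal filter of [a]. *)
Record interval (L : complete_lattice) (a b : L) : Type :=
  Interval { interval_val :> L; interval_valP : a <= interval_val <= b }.

HB.instance Definition _ (L : complete_lattice) (a b : L) :=
  [isSub for @interval_val L a b].
HB.instance Definition _ (L : complete_lattice) (a b : L) :=
  [Choice of interval a b by <:].
HB.instance Definition _ (L : complete_lattice) (a b : L) :=
  [SubChoice_isSubPOrder of interval a b by <: with cl_disp L].

Section Interval.
Variables (L : complete_lattice) (a b : L).
Local Notation I := (interval a b).
Implicit Types x y z : I.

Lemma interval_leE x y : (x <= y) = (interval_val x <= interval_val y).
Proof. by []. Qed.

Lemma interval_meet_subproof x y : a <= interval_val x `&` interval_val y <= b.
Proof.
case: x y => [x /= /andP[ax xb]] [y /= /andP[ay yb]].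
by rewrite lexI ax ay leIxl.
Qed.

Lemma interval_join_subproof x y : a <= interval_val x `|` interval_val y <= b.
Proof.
case: x y => [x /= /andP[ax xb]] [y /= /andP[ay yb]].
by rewrite leUx xb yb lexUl.
Qed.

Definition interval_meet x y : I := Interval (interval_meet_subproof x y).
Definition interval_join x y : I := Interval (interval_join_subproof x y).

Lemma interval_meetP x y z : (x <= interval_meet y z) = (x <= y) && (x <= z).
Proof. by rewrite !interval_leE SubK lexI. Qed.

Lemma interval_joinP x y z : (interval_join x y <= z) = (x <= z) && (y <= z).
Proof. by rewrite !interval_leE SubK leUx. Qed.

HB.instance Definition _ := Order.POrder_MeetJoin_isLattice.Build
  (cl_disp L) (interval a b) interval_meetP interval_joinP.

Hypothesis ab : a <= b.

(* Joining with [a] only matters for the empty set. *)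
Lemma interval_complete (A : set I) : exists s, isLub A s.
Proof.
have lub_b : a <= a `|` lub [set interval_val x | x in A]%classic <= b.
  rewrite leUl leUx ab /=; apply: lub_le => _ [x _ <-].
  by case/andP: (interval_valP x).
exists (Interval lub_b); split=> [x Ax|y ub].
  by rewrite interval_leE SubK lexUr // lub_ub //; exists x.
rewrite interval_leE SubK leUx; case/andP: (interval_valP y) => -> _ /=.
by apply: lub_le => _ [x Ax <-]; apply: ub.
Qed.

(** The interval as an object of [Sup]. *)
Definition interval_lattice : complete_lattice :=
  @CompleteLattice _ (interval a b : latticeType _) interval_complete.

Lemma interval_modular : modular L -> modular interval_lattice.
Proof. by move=> modL x y z xz; apply: val_inj; apply: modL. Qed.

(** The passage between [interval_lattice] and [L], typed so that the order of
    [interval_lattice] is the one of a complete lattice. *)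
Definition in_interval (x : L) (xP : a <= x <= b) : interval_lattice :=
  Interval xP.

Definition interval_incl (w : interval_lattice) : L :=
  interval_val (w : interval a b).

Lemma interval_inclP w : a <= interval_incl w <= b.
Proof. exact: interval_valP. Qed.

Lemma interval_lattice_leE v w : (v <= w) = (interval_incl v <= interval_incl w).
Proof. by []. Qed.

Lemma in_intervalK (x : L) (xP : a <= x <= b) : interval_incl (in_interval xP) = x.
Proof. by []. Qed.

Lemma interval_incl_inj : injective interval_incl.
Proof. exact: (@val_inj _ _ (interval a b)). Qed.

End Interval.

(** The principal ideal of [a], included in [L]. *)
Lemma ideal_inclusion (L : complete_lattice) (a : L) :
  exists i : sup_map (interval_lattice (bot_le a)) L,
    (forall x y, i x <= i y -> x <= y) /\
    (forall y, (exists x, i x = y) <-> y <= a).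
Proof.
pose i := @interval_incl L _ _ (bot_le a).
have i_homo : {homo i : x y / x <= y} by [].
have i_lub A y : (forall x, A x -> i x <= y) -> i (lub A) <= y.
  move=> Ay; have ya : bot L <= y `&` a <= a by rewrite bot_le leIr.
  apply: le_trans (leIl y a); rewrite -(in_intervalK (bot_le a) ya).
  rewrite -interval_lattice_leE; apply: lub_le => x Ax.
  rewrite interval_lattice_leE in_intervalK lexI Ay //.
  by have /andP[] := interval_inclP x.
exists (mk_sup_map i_homo i_lub); split=> // y; split=> [[x <-]|ya].
  by have /andP[] := interval_inclP x.
have ya' : bot L <= y <= a by rewrite bot_le.
by exists (in_interval (bot_le a) ya').
Qed.

(** The projection [x |-> x `|` b] onto the principal filter of [b]. *)
Lemma filter_projection (L : complete_lattice) (b : L) :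
  exists p : sup_map L (interval_lattice (le_top b)),
    (forall w, exists x, p x = w) /\ (forall x y, p x <= p y <-> x <= y `|` b).
Proof.
have bP x : b <= x `|` b <= top L by rewrite leUr le_top.
pose p x := in_interval (le_top b) (bP x).
have p_leE x y : (p x <= p y) = (x <= y `|` b).
  by rewrite interval_lattice_leE !in_intervalK leUx leUr andbT.
have p_homo : {homo p : x y / x <= y}.
  by move=> x y xy; rewrite p_leE lexUl.
have pK w : p (interval_incl w) = w.
  apply: interval_incl_inj; rewrite in_intervalK; apply/join_idPl.
  by have /andP[] := interval_inclP w.
have p_lub A y : (forall x, A x -> p x <= y) -> p (lub A) <= y.
  rewrite -(pK y) p_leE => Ay; apply: lub_le => x Ax.
  by rewrite -p_leE; apply: Ay.
exists (mk_sup_map p_homo p_lub); split=> [w|x y] /=; last by rewrite p_leE.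
by exists (interval_incl w).
Qed.

(** * The bizero object *)

(** A category with exactly one morphism between any two objects is
    equivalent to the terminal category as soon as it is inhabited. *)
Lemma equivalent_terminal (C : category) (c : C) :
  (forall x y : C, mor x y) ->
  (forall (x y : C) (a b : mor x y), a = b) ->
  equivalent C terminal_category.
Proof.
move=> full thin; exists (constF C (tt : terminal_category)).
exists (constF terminal_category c); split.
  exists (fun x => full c x); split=> [*|x]; first exact: thin.
  by exists (full x c); split; apply: thin.
exists (fun _ => tt); split=> [|[]]; first by do 3 case.
by exists tt.
Qed.

Lemma ord1_complete (A : set 'I_1) : exists s, isLub A s.
Proof. by exists ord0; split=> [x _|y _]; rewrite ?ord1 // [x]ord1. Qed.

Definition one_lattice : complete_lattice :=
  @CompleteLattice _ ('I_1 : latticeType _) ord1_complete.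

Lemma one_lattice_eq (x y : one_lattice) : x = y.
Proof. by rewrite [x]ord1 [y]ord1. Qed.

Lemma one_lattice_modular : modular one_lattice.
Proof. by move=> *; apply: one_lattice_eq. Qed.

(** The bizero object: the lattice with one element. *)
Definition one : Sup_mod := exist _ one_lattice one_lattice_modular.

(** The underlying function of a 1-cell. *)
Definition ap (A B : Sup_mod) (f : hom A B) : sval A -> sval B :=
  sup_fun (f : sup_map (sval A) (sval B)).

Section Cells.
Implicit Types A B C : Sup_mod.

Lemma ap_comp A B C (g : hom B C) (f : hom A B) x : ap (g ∘ f) x = ap g (ap f x).
Proof. by []. Qed.

Lemma ap_inj A B (f g : hom A B) : ap f =1 ap g -> f = g.
Proof. exact: sup_map_eq. Qed.

Lemma ap_homo A B (f : hom A B) x y : x <= y -> ap f x <= ap f y.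
Proof. exact: sup_map_homo. Qed.

Lemma ap_lub A B (f : hom A B) (S : set (sval A)) y :
  (forall x, S x -> ap f x <= y) -> ap f (lub S) <= y.
Proof. exact: sup_map_lub. Qed.

Lemma ap_bot A B (f : hom A B) : ap f (bot _) = bot _.
Proof. exact: sup_map_bot. Qed.

Lemma apU A B (f : hom A B) x y : ap f (x `|` y) = ap f x `|` ap f y.
Proof. exact: sup_mapU. Qed.

Lemma point_cell A B (y : sval B) : exists p : hom A B,
  (forall x, ap p x <= y) /\ (forall x, x <> bot _ -> ap p x = y).
Proof. exact: point_map. Qed.
Arguments point_cell : clear implicits.

Lemma copoint_cell A B (y : sval A) : exists p : hom A B,
  (forall x, x <= y -> ap p x = bot _) /\ (forall x, ~ x <= y -> ap p x = top _).
Proof. exact: copoint_map. Qed.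
Arguments copoint_cell : clear implicits.

Lemma isomorphicE A B (f g : hom A B) : f ≅ g <-> f = g.
Proof.
split=> [[fg [gf _]]|->]; last by exists (idm g), (idm g); split; apply: sup_cell_irr.
by apply: ap_inj => x; apply: le_anti; rewrite (fg x) (gf x).
Qed.

Lemma nullE A B (f : hom A B) : null one f <-> forall x, ap f x = bot _.
Proof.
split=> [[p [q ->]] x|f0].
  by rewrite ap_comp -(ap_bot q); congr (ap q _); apply: one_lattice_eq.
have [p _] := point_map (sval A) (bot one_lattice).
have [q _] := point_map one_lattice (bot (sval B)).
exists p, q; apply: ap_inj => x; rewrite f0 -(sup_map_bot q).
by congr (sup_fun q _); apply: one_lattice_eq.
Qed.

Lemma iso_nullE A B (f : hom A B) : iso_null one f <-> forall x, ap f x = bot _.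
Proof.
split=> [[n [/nullE n0 /isomorphicE ->]] //|f0].
by exists f; split; [apply/nullE|apply/isomorphicE].
Qed.

Lemma strong_bizero_one : strong_bizero one.
Proof.
split=> [A|A B f g /nullE f0 /nullE g0]; last first.
  have fg : f ⇒ g by move=> x; rewrite -/(ap f x) f0; apply: bot_le.
  by exists fg; split=> // fg' _; apply: sup_cell_irr.
split.
  have [p _] := point_map (sval A) (bot one_lattice).
  apply: (@equivalent_terminal (@hom Sup_mod A one) p) => f g; last exact: sup_cell_irr.
  by move=> x; rewrite (one_lattice_eq (f x) (g x)).
have [p _] := point_map one_lattice (bot (sval A)).
apply: (@equivalent_terminal (@hom Sup_mod one A) p) => f g; last exact: sup_cell_irr.
move=> x; rewrite (one_lattice_eq x (bot _)) !sup_map_bot.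
exact: lexx.
Qed.

(** * Kernels and cokernels *)

(** [k] is an order embedding whose image is the kernel of [f]. *)
Definition kernel_like A B C (f : hom A B) (k : hom C A) : Prop :=
  (forall x y, ap k x <= ap k y -> x <= y) /\
  (forall y, (exists x, ap k x = y) <-> ap f y = bot _).

(** [c] is, up to isomorphism, the projection [y |-> y `|` ap f (top _)] onto
    the principal filter of [ap f (top _)]. *)
Definition cokernel_like A B C (f : hom A B) (c : hom B C) : Prop :=
  (forall w, exists y, ap c y = w) /\
  (forall x y, ap c x <= ap c y <-> x <= y `|` ap f (top _)).

Lemma two_kernelP A B C (f : hom A B) (k : hom C A) :
  two_kernel one f k <-> kernel_like f k.
Proof.
split=> [[/iso_nullE fk fact refl]|[k_le k_im]].
  split=> [x y kxy|y].
    (* Point maps turn elements of [C] into parallel 1-cells. *)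
    have [->|/eqP x0] := eqVneq x (bot _); first exact: bot_le.
    have [p [_ p_x]] := point_cell C C x.
    have [q [_ q_x]] := point_cell C C y.
    have le : k ∘ p ⇒ k ∘ q.
      move=> z; rewrite -!/(ap _ z) !ap_comp.
      have [->|/eqP z0] := eqVneq z (bot _); first by rewrite !ap_bot.
      by rewrite p_x // q_x.
    have [mu _] := refl _ p q le.
    by have := mu x; rewrite -!/(ap _ x) p_x // q_x.
  split=> [[x <-]|fy0]; first by rewrite -ap_comp fk.
  have [->|/eqP y0] := eqVneq y (bot _).
    by exists (bot _); rewrite ap_bot.
  have [p [p_le p_y]] := point_cell A A y.
  have [|u /isomorphicE ku] := fact A p.
    apply/iso_nullE => x; rewrite ap_comp; apply: le_bot; rewrite -fy0.
    exact/ap_homo/p_le.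
  by exists (ap u y); rewrite -ap_comp ku; apply: p_y.
have fk x : ap f (ap k x) = bot _ by apply/k_im; exists x.
split=> [|Z z /iso_nullE fz|Z u v le].
- by apply/iso_nullE.
- have /choice[u ku] t : exists x, ap k x = ap z t.
    by apply/k_im; rewrite -ap_comp.
  have u_homo : {homo u : x y / x <= y}.
    by move=> x y xy; apply: k_le; rewrite !ku ap_homo.
  have u_lub S y : (forall x, S x -> u x <= y) -> u (lub S) <= y.
    move=> Sy; apply: k_le; rewrite ku; apply: ap_lub => x Sx.
    by rewrite -ku ap_homo // Sy.
  by exists (mk_sup_map u_homo u_lub); apply/isomorphicE/ap_inj.
- have mu : u ⇒ v by move=> x; apply: k_le; apply: le.
  by exists mu; split=> [|? _]; apply: sup_cell_irr.
Qed.

Lemma two_cokernelP A B C (f : hom A B) (c : hom B C) :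
  two_cokernel one f c <-> cokernel_like f c.
Proof.
split=> [[/iso_nullE cf fact refl]|[c_surj c_le]].
  split=> [w|x y].
    (* [y] is the greatest element which [c] maps below [w]. *)
    pose y := lub [set y | ap c y <= w]%classic.
    have cy : ap c y <= w by apply: ap_lub.
    exists y; apply: le_anti; rewrite cy /=; apply: contrapT => wy.
    (* [p ∘ c ⇒ q ∘ c] by the choice of [y], but [p ⇒ q] fails at [w]. *)
    have [p [p_bot p_top]] := copoint_cell C C (ap c y).
    have [q [q_bot q_top]] := copoint_cell C C w.
    have le : p ∘ c ⇒ q ∘ c.
      move=> x; rewrite -!/(ap _ x) !ap_comp.
      have [xw|/negP xw] := boolP (ap c x <= w); last by rewrite q_top // le_top.
      by rewrite p_bot ?bot_le //; apply/ap_homo/lub_ub.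
    have [mu _] := refl _ p q le.
    have := mu w; rewrite -!/(ap _ w) q_bot // p_top // => tb.
    by apply: wy; apply: le_trans (le_top w) (le_trans tb (bot_le _)).
  split=> [cxy|xy].
    (* Being zero on the image of [f], [p] factors through [c]. *)
    have [p [p_bot p_top]] := copoint_cell B B (y `|` ap f (top _)).
    have [|u /isomorphicE uc] := fact B p.
      apply/iso_nullE => t; rewrite ap_comp; apply: p_bot.
      by rewrite lexUr // ap_homo // le_top.
    apply: contrapT => xy.
    have : ap p x <= ap p y by rewrite -uc !ap_comp ap_homo.
    rewrite p_top // p_bot ?leUl // => tb.
    by apply: xy; apply: le_trans (le_top x) (le_trans tb (bot_le _)).
  apply: le_trans (ap_homo c xy) _; rewrite apU -ap_comp cf.
  by rewrite leUx lexx bot_le.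
have cf x : ap c (ap f x) = bot _.
  apply: le_bot; rewrite -(ap_bot c); apply/c_le.
  by rewrite lexUr // ap_homo // le_top.
split=> [|Z z /iso_nullE zf|Z u v le].
- by apply/iso_nullE.
- have [s cs] := choice c_surj.
  have z_le x y : ap c x <= ap c y -> ap z x <= ap z y.
    move=> /c_le /(ap_homo z) /le_trans; apply.
    by rewrite apU -ap_comp zf leUx lexx bot_le.
  have u_homo : {homo (ap z \o s) : x y / x <= y}.
    by move=> x y xy; apply: z_le; rewrite !cs.
  have u_lub S y : (forall x, S x -> (ap z \o s) x <= y) -> (ap z \o s) (lub S) <= y.
    move=> Sy /=; apply: (@le_trans _ _ (ap z (lub [set x | S (ap c x)]%classic))).
      apply: z_le; rewrite cs; apply: lub_le => x Sx; rewrite -(cs x).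
      by apply/ap_homo/lub_ub; rewrite /= cs.
    apply: ap_lub => x /= Sx; apply: le_trans (Sy _ Sx).
    by apply: z_le; rewrite cs.
  exists (mk_sup_map u_homo u_lub); apply/isomorphicE/ap_inj => x.
  by rewrite ap_comp /ap /=; apply: le_anti; rewrite !z_le ?cs.
- have mu : u ⇒ v.
    by move=> w; have [x <-] := c_surj w; apply: le.
  by exists mu; split=> [|? _]; apply: sup_cell_irr.
Qed.

Lemma two_kernel_exists A B (f : hom A B) :
  exists (X : Sup_mod) (k : hom X A), two_kernel one f k.
Proof.
pose a := lub [set x | ap f x = bot _]%classic.
have [i [i_le i_im]] := ideal_inclusion a.
exists (exist _ _ (@interval_modular _ _ _ (bot_le a) (svalP A))), i.
apply/two_kernelP; split=> // y; rewrite /ap i_im -/(ap _ _).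
split=> [ya|fy]; last exact: lub_ub.
apply: le_bot; apply: le_trans (ap_homo f ya) _.
by apply: ap_lub => x /= ->.
Qed.

Lemma two_cokernel_exists A B (f : hom A B) :
  exists (X : Sup_mod) (c : hom B X), two_cokernel one f c.
Proof.
have [p pP] := filter_projection (ap f (top _)).
exists (exist _ _ (@interval_modular _ _ _ (le_top (ap f (top _))) (svalP B))), p.
exact/two_cokernelP.
Qed.

(** * Antinormal 1-cells *)

(** [m] is a normal 2-monomorphism and [e] is the projection onto the principal
    filter of [b]; both are given by their order-theoretic description. *)
Section Antinormal.
Variables (A L B : Sup_mod) (m : hom A L) (e : hom L B) (b : sval L).
Hypothesis m_le : forall x y, ap m x <= ap m y -> x <= y.
Hypothesis m_down : forall x y, y <= ap m x -> exists y', ap m y' = y.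
Hypothesis e_surj : forall w, exists y, ap e y = w.
Hypothesis e_le : forall x y, ap e x <= ap e y <-> x <= y `|` b.

(** By modularity [(m y `|` b) `&` m top = m y `|` (b `&` m top)], and
    [b `&` m top] is the image of an element killed by [e ∘ m]. *)
Lemma antinormal_le x y : ap (e ∘ m) x <= ap (e ∘ m) y ->
  exists2 a, ap (e ∘ m) a = bot _ & x <= y `|` a.
Proof.
rewrite !ap_comp => /e_le mxy.
have [a ma] : exists a, ap m a = b `&` ap m (top _).
  by apply: (m_down (x := top _)); apply: leIr.
exists a.
  rewrite ap_comp ma; apply: le_bot; rewrite -(ap_bot e); apply/e_le.
  by rewrite lexUr // leIl.
apply: m_le; rewrite apU ma (svalP L); last by rewrite ap_homo // le_top.
by rewrite lexI mxy ap_homo // le_top.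
Qed.

(** An element below [e (m x)] is [e v] with [b <= v <= m x `|` b], and then
    [v = b `|` (m x `&` v)] by modularity. *)
Lemma antinormal_down x w : w <= ap (e ∘ m) x -> exists y, ap (e ∘ m) y = w.
Proof.
rewrite ap_comp; have [v <-] := e_surj w => /e_le vx.
have [y my] : exists y, ap m y = ap m x `&` (v `|` b).
  by apply: (m_down (x := x)); apply: leIl.
exists y; rewrite ap_comp my; apply: le_anti; apply/andP; split.
  by apply/e_le; apply: leIr.
apply/e_le; rewrite joinC (svalP L) ?leUr // lexI leUl andbT joinC //.
Qed.

End Antinormal.

Lemma antinormal_normal A B (f : hom A B) : antinormal one f -> normal one f.
Proof.
case=> L [m [e [[L' [g /two_kernelP[m_le m_im]]] [K [h /two_cokernelP[e_surj e_le]]]]]].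
move=> /isomorphicE fE.
have m_down x y : y <= ap m x -> exists y', ap m y' = y.
  move=> yx; apply/m_im/le_bot; apply: le_trans (ap_homo g yx) _.
  by rewrite (_ : ap g _ = bot _) //; apply/m_im; exists x.
(* The two consequences of modularity, then the kernel [k] of [f], the
   coimage [c] and the factorization [f = n ∘ c]. *)
have f_le := antinormal_le m_le m_down e_le.
have f_down := antinormal_down m_down e_surj e_le.
rewrite -fE in f_le f_down.
have [X [k kP]] := two_kernel_exists f.
have [I [c cP]] := two_cokernel_exists k.
have [Q [q qP]] := two_cokernel_exists f.
have [fk0 _ _] := kP; have [_ /(_ _ _ fk0)[n /isomorphicE nc] _] := cP.
exists I, c, n; split; last by apply/isomorphicE.
  by exists X, k.
exists Q, q; apply/two_kernelP.
have [_ k_im] := iffLR (two_kernelP _ _) kP.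
have [c_surj c_le] := iffLR (two_cokernelP _ _) cP.
have [_ q_le] := iffLR (two_cokernelP _ _) qP.
have nE x : ap n (ap c x) = ap f x by rewrite -ap_comp nc.
split=> [i j|y].
  have [[x <-] [y <-]] := (c_surj i, c_surj j).
  rewrite !nE => /f_le[a /k_im[a' <-]] xy.
  by apply/c_le/(le_trans xy); rewrite leUx leUl lexUr // ap_homo // le_top.
split=> [[i <-]|qy].
  have [x <-] := c_surj i; apply: le_bot; rewrite nE -(ap_bot q); apply/q_le.
  by rewrite lexUr // ap_homo // le_top.
have /f_down[x <-] : y <= ap f (top _).
  have /q_le : ap q y <= ap q (bot _) by rewrite qy ap_bot.
  by move=> /le_trans; apply; rewrite leUx bot_le lexx.
by exists (ap c x).
Qed.

End Cells.

Theorem theorem8p37 : two_di_exact Sup_mod.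
Proof.
exists one; split.
- exact: strong_bizero_one.
- exact: two_kernel_exists.
- exact: two_cokernel_exists.
- exact: antinormal_normal.
Qed.
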